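(* Let $n$ be a positive integer and let $(a,b)$ be an open interval. A $C^{2n}$ function $f:(a,b)\to\mathbb{R}$ is $n$-convex on $(a,b)$ if and only if the Hankel matrix $$K(t)=\left(\frac{f^{(i+j)}(t)}{(i+j)!}\right)_{1\le i,j\le n}$$ is positive semi-definite for every $t\in(a,b)$.
   Context: For an open interval $(a,b)$, a function $f:(a,b)\to\mathbb{R}$ is called matrix convex of order $n$ (or $n$-convex) if for all $n\times n$ Hermitian matrices $A,B$ with spectra in $(a,b)$ and all $\lambda\in[0,1]$ one has $f(\lambda A+(1-\lambda)B)\le\lambda f(A)+(1-\lambda)f(B)$. Here $f(A)$ is defined by the functional calculus, and $X\le Y$ means that $Y-X$ is positive semi-definite. *)

(* Defs.v *)
From HB Require Import structures.
From mathcomp Require Import all_boot all_order all_algebra spectral sesquilinear.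
From mathcomp Require Import complex.
From mathcomp Require Import all_classical all_reals all_analysis.

Set Implicit Arguments.
Unset Strict Implicit.
Unset Printing Implicit Defensive.

Import Order.TTheory GRing.Theory Num.Theory.
Import numFieldNormedType.Exports.

Local Open Scope classical_set_scope.
Local Open Scope ring_scope.
Local Open Scope complex_scope.
Local Open Scope sesquilinear_scope.

(* The endpoints may be infinite. *)
Definition open_itv (R : realType) (a b : \bar R) : set R :=
  [set x : R | (a < x%:E)%E && (x%:E < b)%E].

Definition psdmx (R : realType) (n : nat) (A : 'M[R[i]]_n) : Prop :=
  A \is hermsymmx /\ forall v : 'cV[R[i]]_n, 0 <= (v ^t* *m A *m v) 0 0.

Definition loewner_le (R : realType) (n : nat) (A B : 'M[R[i]]_n) : Prop :=
  psdmx (B - A).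

Definition spectrum_in (R : realType) (n : nat) (I : set R)
    (A : 'M[R[i]]_n) : Prop :=
  forall z : R[i], eigenvalue A z -> exists2 x : R, I x & z = x%:C.

(* Functional calculus on Hermitian matrices, whose eigenvalues are real:     *)
(* if A = P^-1 diag(d) P with P unitary, then f(A) = P^-1 diag(f(d)) P. The   *)
(* result does not depend on the diagonalization chosen by [spectralmx], and  *)
(* only the values of f on the spectrum of A matter.                          *)
Definition mxfun (R : realType) (n : nat) (f : R -> R)
    (A : 'M[R[i]]_n) : 'M[R[i]]_n :=
  invmx (spectralmx A) *m
  diag_mx (map_mx (fun z : R[i] => (f (complex.Re z))%:C) (spectral_diag A)) *m
  spectralmx A.

Definition matrix_convex (R : realType) (n : nat) (I : set R)
    (f : R -> R) : Prop :=
  forall (A B : 'M[R[i]]_n) (l : R),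
    A \is hermsymmx -> B \is hermsymmx ->
    spectrum_in I A -> spectrum_in I B ->
    0 <= l <= 1 ->
    loewner_le (mxfun f (l%:C *: A + (1 - l)%:C *: B))
               (l%:C *: mxfun f A + (1 - l)%:C *: mxfun f B).

(* For I open, so that the derivatives at points of I only depend on the      *)
(* restriction of f to I.                                                     *)
Definition Cn_on (R : realType) (m : nat) (I : set R) (f : R -> R) : Prop :=
  (forall (k : nat) (x : R), (k < m)%N -> I x -> derivable (derive1n k f) x 1) /\
  (forall x : R, I x -> {for x, continuous (derive1n m f)}).

(* Rows and columns are indexed from 0 here, hence the successors. The real   *)
(* entries are embedded in R[i] so that [psdmx] applies.                      *)
Definition hankelmx (R : realType) (n : nat) (f : R -> R) (t : R) :
    'M[R[i]]_n :=
  \matrix_(i < n, j < n)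
    (derive1n (i.+1 + j.+1) f t / ((i.+1 + j.+1)`!)%:R)%:C.

(* Main.v *)
Require Import Defs.
From mathcomp Require Import all_boot all_order all_algebra spectral sesquilinear.
From mathcomp Require Import complex ring lra zify.
From mathcomp Require Import all_classical all_reals all_analysis.

(* Let M have an orthonormal eigenbasis with eigenvalues be_i, and A one with *)
(* eigenvalues al_k. Up to a term which is linear in A - M, hence cancels in  *)
(* a convex combination with value M, the form v^*(f(A) - f(M))v is the sum   *)
(* over k of                                                                  *)
(*   sum_ij conj(x_i) x_j (f(a) - f(be_i) - (a - be_i) f[be_i, be_j])         *)
(* with a = al_k, where the bracket is (a - be_i)(a - be_j) f[a, be_i, be_j]. *)
(* It vanishes if a is be_i or be_j, so one may assume that a is not a node.  *)
(* If x is real, this is the divided difference of q^2 f at a and at the      *)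
(* doubled nodes be_i, where q is the polynomial of degree < n with           *)
(* q(be_i) = x_i (a - be_i) prod_(j != i) (be_i - be_j). By Rolle it equals   *)
(* (q^2 f)^(2n)(z) / (2n)! for some z, which by Leibniz is the value of the   *)
(* Hankel form K(z) at the Taylor coefficients of q at z: this proves that    *)
(* the condition is sufficient.                                               *)
(* Conversely, a vector on which K(t) is negative gives q such that           *)
(* (q^2 f)^(2n) < 0 near t. For M diagonal with n eigenvalues close to t and  *)
(* A = M +- d J, J the all-ones matrix, the vectors x attached to the various *)
(* k all lead to multiples of this same q because J has rank one, and so      *)
(* every term of the sum is nonpositive and one of them is negative.          *)

(** Write M = lA + (1-l)B in its eigenbasis. Subtract from f(A) - f(M) the derivative of f at M in
    the direction A - M, whose entries are those of A - M multiplied by the divided differences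
    f[be_i, be_j]. The same is done for B; since M is the mean of A and B, the two corrections
    cancel, and the convexity gap becomes a sum of second-order remainder forms, one for each
    eigenvector of A and of B ([convexity_gap]).

    Everything then rests on a mean value theorem, [remainder_form_hankel]: for real coefficients
    and distinct nodes, such a form is the value of the Hankel form at some point z of the interval,
    on the reversed Taylor coefficients at z of a polynomial q.

    If the Hankel forms are nonnegative, so is every remainder form ([remainder_form_ge0]), and f is
    n-convex. If some Hankel form is negative, q is prescribed accordingly ([remainder_form_lt0]),
    and rank one perturbations of a diagonal matrix make every eigenvector meet this q
    ([remainder_term_perturb]), so that midpoint convexity fails ([hankel_form_ge0]). *)

Set Implicit Arguments.
Unset Strict Implicit.
Unset Printing Implicit Defensive.

Import Order.TTheory GRing.Theory Num.Theory.
Import numFieldNormedType.Exports.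

Local Open Scope classical_set_scope.
Local Open Scope ring_scope.
Local Open Scope complex_scope.
Local Open Scope sesquilinear_scope.

(** * Taylor coefficients, Lagrange interpolation and double roots *)

Section polynomials.
Variable F : fieldType.
Implicit Types (p q : {poly F}) (s : seq F).

Lemma coef_comp_XaddC p c i : (p \Po ('X + c%:P))`_i = p^`N(i).[c].
Proof.
elim/poly_ind: p i => [|p a IH] i.
  by rewrite comp_poly0 coef0 linear0 horner0.
rewrite comp_poly_MXaddC coefD mulrDr coefD coefMX coefMC coefC.
case: i => [|i] /=.
  by rewrite IH !nderivn0 !hornerE ?add0r.
by rewrite nderivnMXaddC !hornerE !IH mulrC.
Qed.

Lemma derivn_size_leq p n : (size p <= n.+1)%N -> p^`(n) = (p`_n *+ n`!)%:P.
Proof.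
move=> sp; apply/polyP => i; rewrite coef_derivn coefC.
case: i => [|i] /=; first by rewrite addn0 ffactnn.
rewrite nth_default ?mul0rn //; apply: leq_trans sp _.
by rewrite addnS ltnS leq_addr.
Qed.

(** Only the exponents up to 2m - 2 occur in the square, and the bound on N says that the range i <
    N reaches them. *)
Lemma sum_coef_sqr p m (a : nat -> F) N : (size p <= m)%N -> (m + m <= N.+1)%N ->
  \sum_(i < N) (p ^+ 2)`_i * a i =
  \sum_(k < m) \sum_(l < m) p`_k * p`_l * a (k + l)%N.
Proof.
move=> sp mN.
have pE : p = \sum_(k < m) p`_k *: 'X^k.
  rewrite -poly_def; apply/polyP => i; rewrite coef_poly.
  by case: ltnP => // mi; rewrite nth_default // (leq_trans sp).
have p2E : p ^+ 2 = \sum_(k < m) \sum_(l < m) (p`_k * p`_l) *: 'X^(k + l).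
  rewrite expr2 [X in X * _]pE [X in _ * X]pE big_distrl /=; apply: eq_bigr => k _.
  rewrite big_distrr /=; apply: eq_bigr => l _.
  by rewrite -scalerAl -scalerAr scalerA exprD.
under eq_bigr => i _.
  rewrite p2E coef_sum big_distrl /=.
  under eq_bigr => k _ do rewrite coef_sum big_distrl /=.
  over.
rewrite exchange_big /=; apply: eq_bigr => k _.
rewrite exchange_big /=; apply: eq_bigr => l _.
have klN : (k + l < N)%N by have := ltn_ord k; have := ltn_ord l; lia.
rewrite (bigD1 (Ordinal klN)) //= coefZ coefXn eqxx mulr1 big1 ?addr0 // => i.
rewrite -val_eqE /= => /negPf il.
by rewrite coefZ coefXn il mulr0 mul0r.
Qed.

Definition nodal s : {poly F} := \prod_(c <- s) ('X - c%:P).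

Definition nodal_except s c : {poly F} := \prod_(d <- s | d != c) ('X - d%:P).

(** The Lagrange basis without its normalisation: over distinct nodes, [w c] is the value at c
    divided by [(nodal_except s c).[c]]. *)
Definition nodal_comb s (w : F -> F) : {poly F} :=
  \sum_(c <- s) w c *: nodal_except s c.

Lemma nodalE s c : uniq s -> c \in s -> nodal s = ('X - c%:P) * nodal_except s c.
Proof. by move=> us cs; rewrite /nodal (bigD1_seq c). Qed.

Lemma size_nodal s : size (nodal s) = (size s).+1.
Proof. exact: size_prod_XsubC. Qed.

Lemma nodal_monic s : nodal s \is monic.
Proof. exact: monic_prod_XsubC. Qed.

Lemma size_nodal_except s c : uniq s -> c \in s -> size (nodal_except s c) = size s.
Proof.
move=> us cs; have := size_nodal s.
rewrite (nodalE us cs) size_Mmonic ?polyXsubC_eq0 ?monic_prod_XsubC //.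
by rewrite size_XsubC => -[].
Qed.

Lemma nodal_except_root s c d : d \in s -> d != c -> (nodal_except s c).[d] = 0.
Proof.
move=> ds dc; rewrite horner_prod (big_rem d) //= dc.
by rewrite !hornerE subrr mul0r.
Qed.

Lemma nodal_except_neq0_at s c : (nodal_except s c).[c] != 0.
Proof.
rewrite horner_prod; elim/big_ind: _ => [|x y x0 y0|d dc]; first exact: oner_neq0.
  by rewrite mulf_neq0.
by rewrite !hornerE subr_eq0 eq_sym.
Qed.

Lemma size_nodal_comb s w : uniq s -> (size (nodal_comb s w) <= size s)%N.
Proof.
move=> us; rewrite /nodal_comb big_seq.
apply: (leq_trans (size_sum _ _ _)); apply/bigmax_leqP_seq => c _ cs.
by rewrite (leq_trans (size_scale_leq _ _)) // size_nodal_except.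
Qed.

Lemma nodal_comb_at s w c : uniq s -> c \in s ->
  (nodal_comb s w).[c] = w c * (nodal_except s c).[c].
Proof.
move=> us cs; rewrite /nodal_comb horner_sum (bigD1_seq c) //= big_seq_cond big1.
  by rewrite addr0 hornerZ.
by move=> d /andP[ds dc]; rewrite hornerZ nodal_except_root ?mulr0 // eq_sym.
Qed.

(** Uniqueness of interpolation: the difference of the two sides has too many roots for its size. *)
Lemma nodal_comb_interp s p : uniq s -> (size p <= size s)%N ->
  p = nodal_comb s (fun c => p.[c] / (nodal_except s c).[c]).
Proof.
move=> us sp; apply/eqP; rewrite -subr_eq0; apply/negPn/negP => d0.
set d := p - _ in d0.
have rd : all (root d) s.
  apply/allP => c cs; rewrite /root /d hornerD hornerN nodal_comb_at //.
  by rewrite divfK ?nodal_except_neq0_at ?subrr.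
have := max_poly_roots d0 rd us.
rewrite ltnNge => /negP; apply.
rewrite (leq_trans (size_polyD _ _)) // geq_max sp size_polyN.
exact: size_nodal_comb.
Qed.

Definition double_root p c := (p.[c] == 0) && (p^`().[c] == 0).

Lemma double_rootM p q c : p.[c] = 0 -> q.[c] = 0 -> double_root (p * q) c.
Proof.
move=> p0 q0; rewrite /double_root derivM !hornerE p0 q0.
by rewrite !(mul0r, mulr0) addr0 eqxx.
Qed.

Lemma double_rootMl p q c : double_root p c -> double_root (q * p) c.
Proof.
by case/andP=> /eqP p0 /eqP p1;
  rewrite /double_root derivM !hornerE p0 p1 !mulr0 addr0 eqxx.
Qed.

Lemma double_rootD p q c :
  double_root p c -> double_root q c -> double_root (p + q) c.
Proof.
move=> /andP[/eqP p0 /eqP p1] /andP[/eqP q0 /eqP q1].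
by rewrite /double_root derivD !hornerE p0 p1 q0 q1 addr0 eqxx.
Qed.

Lemma double_root_sum (J : Type) (r : seq J) (P : pred J) (G : J -> {poly F}) c :
  (forall i, P i -> double_root (G i) c) -> double_root (\sum_(i <- r | P i) G i) c.
Proof.
move=> H; elim/big_ind: _ => // [|p q p0 q0]; last exact: double_rootD.
by rewrite /double_root deriv0 horner0 eqxx.
Qed.

End polynomials.

(** * Iterated Rolle theorem and the Leibniz formula *)

Section rolle.
Variables (R : realType) (I : set R).
Hypothesis itvI : is_interval I.
Implicit Types (h : nat -> R -> R) (p q : {poly R}) (s b : seq R).

(** A tower of derivatives given as a sequence, so that products with polynomials and differences
    come with explicit derivatives of all orders. *)
Definition derivs N h :=
  forall k x, (k < N)%N -> I x -> is_derive x (1 : R) (h k) (h k.+1 x).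

Lemma derivs_le N M h : (M <= N)%N -> derivs N h -> derivs M h.
Proof. by move=> MN dh k x kM; apply: dh; apply: leq_trans MN. Qed.

Lemma rolle_seq h x s : derivs 1 h -> I x -> (forall c, c \in s -> I c) ->
  path <%R x s -> (forall c, c \in x :: s -> h 0%N c = 0) ->
  exists r : seq R, [/\ size r = size s, uniq r,
    forall c, c \in r -> [/\ I c, x < c & h 1%N c = 0] &
    forall c, c \in r -> c \notin x :: s].
Proof.
move=> dh; elim: s x => [|y s IH] x Ix Is /=.
  by move=> _ _; exists [::]; split.
move=> /andP[xy ps] z0.
have Iy : I y by apply: Is; rewrite mem_head.
have Ixy z : x <= z <= y -> I z by apply: itvI.
have dxy z : z \in `]x, y[ -> derivable (h 0%N) z 1.
  rewrite in_itv /= => /andP[xz zy].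
  by have [] := dh 0%N z isT (Ixy z _); rewrite ?ltW.
have cxy : {within `[x, y], continuous (h 0%N)}.
  apply: derivable_within_continuous => z; rewrite in_itv /= => zI.
  by have [] := dh 0%N z isT (Ixy z zI).
have hxy : h 0%N x = h 0%N y by rewrite !z0 ?inE ?eqxx ?orbT.
have [c] := Rolle xy dxy cxy hxy.
rewrite in_itv /= => /andP[xc cy] dc.
have Ic : I c by apply: Ixy; rewrite !ltW.
have hc : h 1%N c = 0.
  by have [_ <-] := dh 0%N c isT Ic; have [_ <-] := dc.
have Is' z : z \in s -> I z by move=> zs; apply: Is; rewrite inE zs orbT.
have z0' z : z \in y :: s -> h 0%N z = 0.
  by move=> zs; apply: z0; rewrite inE zs orbT.
have [r [sr ur rP rn]] := IH y Iy Is' ps z0'.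
have ys z : z \in y :: s -> y <= z.
  rewrite inE => /predU1P[->//|zs].
  by have /allP/(_ z zs)/ltW := order_path_min lt_trans ps.
exists (c :: r); split => /=.
- by rewrite sr.
- rewrite ur andbT; apply/negP => /rP[_ yc _].
  by have := lt_trans yc cy; rewrite ltxx.
- move=> z; rewrite inE => /predU1P[->//|/rP[Iz yz hz]]; split=> //.
  exact: lt_trans xy yz.
- move=> z; rewrite inE => /predU1P[->|zr].
    rewrite inE negb_or (gt_eqF xc) /=; apply/negP => /ys yc.
    by have := lt_le_trans cy yc; rewrite ltxx.
  rewrite inE negb_or (rn _ zr) andbT.
  by have [_ yz _] := rP _ zr; rewrite gt_eqF // (lt_trans xy).
Qed.

Lemma rolle_uniq h s m : derivs 1 h -> (forall c, c \in s -> I c) ->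
  uniq s -> size s = m.+1 -> (forall c, c \in s -> h 0%N c = 0) ->
  exists r : seq R, [/\ size r = m, uniq r,
    forall c, c \in r -> I c /\ h 1%N c = 0 &
    forall c, c \in r -> c \notin s].
Proof.
move=> dh Is us ss z0.
have := sort_lt_sorted s; rewrite us.
have := mem_sort <=%R s; have := size_sort <=%R s; rewrite ss.
case: (sort _ s) => [//|x t] [st] mt /= pt.
have Ix : I x by apply: Is; rewrite -mt mem_head.
have It c : c \in t -> I c by move=> ct; apply: Is; rewrite -mt inE ct orbT.
have zt c : c \in x :: t -> h 0%N c = 0 by rewrite mt => /z0.
have [r [sr ur rP rn]] := rolle_seq dh Ix It pt zt.
exists r; split=> //; first by rewrite sr.
  by move=> c /rP[].
by move=> c /rn; rewrite mt.
Qed.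

Lemma rolle_iter N h s : derivs N h -> (forall c, c \in s -> I c) ->
  uniq s -> size s = N.+1 -> (forall c, c \in s -> h 0%N c = 0) ->
  exists2 c, I c & h N c = 0.
Proof.
elim: N h s => [|N IH] h s dh Is us ss z0.
  case: s ss Is z0 {us} => [//|c s _] Is z0.
  by exists c; [apply: Is|apply: z0]; rewrite mem_head.
have [r [sr ur rP _]] := rolle_uniq (derivs_le (ltn0Sn N) dh) Is us ss z0.
apply: (IH (fun k => h k.+1) r) => // [k x kN|c /rP[]//|c /rP[]//].
exact: dh.
Qed.

(* Hermite data: [a] is a simple zero, the points of [b] are double ones. *)
Lemma rolle_double h b a : derivs (size b).*2 h ->
  I a -> (forall c, c \in b -> I c) -> uniq (a :: b) -> h 0%N a = 0 ->
  (forall c, c \in b -> h 0%N c = 0 /\ h 1%N c = 0) ->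
  exists2 c, I c & h (size b).*2 c = 0.
Proof.
case: b => [|e b] dh Ia Ib ub ha hb; first by exists a.
have Iab c : c \in a :: e :: b -> I c by rewrite inE => /predU1P[->//|/Ib].
have zab c : c \in a :: e :: b -> h 0%N c = 0 by rewrite inE => /predU1P[->//|/hb[]].
have dh1 : derivs 1 h by apply: derivs_le dh.
have [r [sr ur rP rn]] := rolle_uniq dh1 Iab ub erefl zab.
rewrite /= doubleS.
(* With m double nodes, the m zeros of [h 1] between the m + 1 zeros of [h 0] and the nodes
   themselves make 2m distinct zeros of [h 1], enough for 2m - 1 further derivatives. *)
apply: (@rolle_iter (size b).*2.+1 (fun k => h k.+1) (r ++ (e :: b))).
- by move=> k x kN; apply: dh; rewrite /= doubleS.
- by move=> c; rewrite mem_cat => /orP[/rP[]|/Ib].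
- move: ub; rewrite cons_uniq cat_uniq ur => /andP[_ ->]; rewrite andbT.
  by apply/hasPn => c cb; apply/negP => /rn; rewrite inE cb orbT.
- by rewrite size_cat sr /= -addnn addnS.
- by move=> c; rewrite mem_cat => /orP[/rP[]|/hb[]].
Qed.

Lemma derivs_poly p N : derivs N (fun k x => (p^`(k)).[x]).
Proof. by move=> k x _ _; rewrite derivnS; apply: is_derive_poly. Qed.

Lemma derivsB N h h' : derivs N h -> derivs N h' ->
  derivs N (fun k x => h k x - h' k x).
Proof.
move=> dh dh' k x kN Ix.
by apply: is_deriveB; [apply: dh|apply: dh'].
Qed.

Definition leibniz p h k x :=
  \sum_(i < k.+1) (p^`(i)).[x] * h (k - i)%N x *+ 'C(k, i).

(** Pascal's rule regroups the sum so that each summand is the derivative of a summand of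
    [leibniz p h k]. *)
Lemma leibnizS p h k x : leibniz p h k.+1 x =
  \sum_(i < k.+1) ((p^`(i.+1)).[x] * h (k - i)%N x +
                   (p^`(i)).[x] * h (k - i).+1 x) *+ 'C(k, i).
Proof.
under [RHS]eq_bigr do rewrite mulrnDl.
rewrite big_split /= /leibniz big_ord_recl /= bin0 subn0.
under eq_bigr => i _ do rewrite /bump leq0n add1n subSS binS mulrnDr.
rewrite big_split /= addrA addrC; congr (_ + _).
rewrite [in RHS]big_ord_recl /= bin0 subn0; congr (_ + _).
rewrite big_ord_recr /= bin_small // mulr0n addr0; apply: eq_bigr => i _.
by rewrite /bump leq0n add1n subnSK.
Qed.

Lemma derivs_leibniz p h N : derivs N h -> derivs N (leibniz p h).
Proof.
move=> dh k x kN Ix; rewrite leibnizS.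
have -> : leibniz p h k =
    \sum_(i < k.+1) (fun x => (p^`(i)).[x] * h (k - i)%N x *+ 'C(k, i)).
  by apply/funext => y; rewrite /leibniz fct_sumE.
apply: is_derive_sum => i.
rewrite -mulr_natl.
have -> : (fun x => (p^`(i)).[x] * h (k - i)%N x *+ 'C(k, i)) =
          ('C(k, i)%:R : R) *: (horner p^`(i) * h (k - i)%N).
  by apply/funext => y; rewrite -mulr_natl.
apply: is_deriveZ.
have dki : is_derive x (1 : R) (h (k - i)%N) (h (k - i).+1 x).
  by apply: dh => //; apply: leq_ltn_trans (leq_subr _ _) kN.
have dp : is_derive x (1 : R) (horner p^`(i)) (p^`(i.+1)).[x].
  by rewrite derivnS; apply: is_derive_poly.
apply: (is_derive_eq (is_deriveM dp dki)).
by rewrite /GRing.scale /= addrC [X in X + _]mulrC.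
Qed.

Lemma leibniz_fact p h k x : leibniz p h k x =
  k`!%:R * \sum_(i < k.+1) (p^`N(i)).[x] * (h (k - i)%N x / (k - i)`!%:R).
Proof.
rewrite /leibniz big_distrr /=; apply: eq_bigr => i _.
have ik : (i <= k)%N by rewrite -ltnS.
rewrite nderivn_def hornerMn -(bin_fact ik).
have f0 : ((k - i)`!%:R : R) != 0 by rewrite pnatr_eq0 -lt0n fact_gt0.
rewrite -(mulr_natl (_ * _)) -(mulr_natl (p^`N(i)).[x]) !natrM.
by field.
Qed.

(* [h k] stands for the k-th derivative of f. *)
Definition hankel_form h m (u : nat -> R) (t : R) : R :=
  \sum_(i < m) \sum_(j < m)
     u i * u j * (h (i.+1 + j.+1)%N t / (i.+1 + j.+1)`!%:R).

(** If q_k are the Taylor coefficients of q at x, the Leibniz sum consists of the q_k q_l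
    f^(2m-k-l)/(2m-k-l)!. As k, l < m, replacing k by m-1-i and l by m-1-j turns the order into
    (i+1)+(j+1): this is where the Hankel matrix, starting at order 2, comes from. *)
Lemma leibniz_sqr_hankel q h m x : (size q <= m)%N ->
  leibniz (q ^+ 2) h m.*2 x =
  m.*2`!%:R * hankel_form h m (fun i => (q^`N(m - i.+1)).[x]) x.
Proof.
move=> sq; rewrite leibniz_fact; congr (_ * _).
have s2 : (size (q \Po ('X + x%:P)) <= m)%N.
  by rewrite size_comp_poly2 // -[x%:P]opprK -polyCN size_XsubC.
under eq_bigr => i _ do rewrite -coef_comp_XaddC rmorphXn.
have mm : (m + m <= m.*2.+2)%N by rewrite addnn !leqW.
rewrite (sum_coef_sqr (fun i => h (m.*2 - i)%N x / (m.*2 - i)`!%:R) s2 mm).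
rewrite (reindex_inj rev_ord_inj) /=; apply: eq_bigr => i _.
rewrite (reindex_inj rev_ord_inj) /=; apply: eq_bigr => j _.
rewrite !coef_comp_XaddC.
suff -> : (m.*2 - (m - i.+1 + (m - j.+1)))%N = (i.+1 + j.+1)%N by [].
by have := ltn_ord i; have := ltn_ord j; lia.
Qed.

End rolle.

(** * Divided differences and the Hermite interpolation error *)

Section divided_differences.
Variables (R : realType) (I : set R).
Hypothesis itvI : is_interval I.
Implicit Types (h : nat -> R -> R) (b : seq R).

Definition divdiff h (x y : R) : R :=
  if x == y then h 1%N x else (h 0%N x - h 0%N y) / (x - y).

Lemma divdiffC h x y : divdiff h x y = divdiff h y x.
Proof.
rewrite /divdiff eq_sym; case: eqVneq => [->//|yx].
by rewrite -opprB -[x - y]opprB invrN mulrNN.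
Qed.

Lemma divdiffM h x y : (x - y) * divdiff h x y = h 0%N x - h 0%N y.
Proof.
rewrite /divdiff; case: eqVneq => [->|xy]; first by rewrite !subrr mul0r.
by rewrite mulrC divfK // subr_eq0.
Qed.

(* When a, x, y are distinct this is (a - x) (a - y) f[a, x, y]. *)
Definition remainder h (a x y : R) : R :=
  h 0%N a - h 0%N x - (a - x) * divdiff h x y.

Lemma remainderC h a x y : remainder h a x y = remainder h a y x.
Proof.
by have := divdiffM h x y; rewrite /remainder (divdiffC h y x); lra.
Qed.

Lemma remainder_id h a y : remainder h a a y = 0.
Proof. by rewrite /remainder !subrr mul0r subrr. Qed.

Section hermite.
Variables (h : nat -> R -> R) (b : seq R) (w : R -> R).
Hypothesis ub : uniq b.

(** The last factor is the line interpolating f at c and d, the tangent when c = d. *)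
Definition hermite_term (c d : R) : {poly R} :=
  nodal_except b c * nodal_except b d *
  ((h 0%N c)%:P + divdiff h c d *: ('X - c%:P)).

(* The Hermite interpolant of [q ^+ 2 * f] at the doubled nodes b, where      *)
(* [q := nodal_comb b w].                                                     *)
Definition hermite : {poly R} :=
  \sum_(c <- b) \sum_(d <- b) (w c * w d) *: hermite_term c d.

Lemma size_hermite : (size hermite <= (size b).*2)%N.
Proof.
rewrite /hermite big_seq; apply: (leq_trans (size_sum _ _ _)).
apply/bigmax_leqP_seq => c _ cb.
rewrite big_seq; apply: (leq_trans (size_sum _ _ _)).
apply/bigmax_leqP_seq => d _ db.
apply: (leq_trans (size_scale_leq _ _)).
apply: (leq_trans (size_polyMleq _ _)).
have s1 : (size (nodal_except b c * nodal_except b d)%R <= (size b + size b).-1)%N.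
  by apply: (leq_trans (size_polyMleq _ _)); rewrite !size_nodal_except.
have s2 : (size ((h 0%N c)%:P + divdiff h c d *: ('X - c%:P))%R <= 2)%N.
  apply: (leq_trans (size_polyD _ _)); rewrite geq_max.
  rewrite (leq_trans (size_polyC_leq1 _)) //=.
  by rewrite (leq_trans (size_scale_leq _ _)) // size_XsubC.
have : (0 < size b)%N by case: (b) cb.
by rewrite -subn1 leq_subLR => b0; rewrite (leq_trans (leq_add s1 s2)) //; lia.
Qed.

(** To first order at e, f may be replaced by its tangent there. In each term, [nodal_except]
    vanishes at e unless its index is e, while the line through c and d minus the tangent vanishes
    at e if one of c, d is e, and identically if both are. *)
Lemma hermite_double_root e : e \in b ->
  double_root (hermite - nodal_comb b w ^+ 2 *
                         ((h 0%N e)%:P + h 1%N e *: ('X - e%:P))) e.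
Proof.
move=> eb.
have -> : hermite - nodal_comb b w ^+ 2 * ((h 0%N e)%:P + h 1%N e *: ('X - e%:P)) =
  \sum_(c <- b) \sum_(d <- b) (w c * w d)%:P *
    (nodal_except b c * nodal_except b d *
      (((h 0%N c)%:P + divdiff h c d *: ('X - c%:P)) -
       ((h 0%N e)%:P + h 1%N e *: ('X - e%:P)))).
  rewrite expr2 [in X in _ - X]/nodal_comb !big_distrl /= -sumrB.
  apply: eq_bigr => c _; rewrite big_distrr /= big_distrl /= -sumrB.
  by apply: eq_bigr => d _; rewrite /hermite_term -!mul_polyC polyCM; ring.
apply: double_root_sum => c _; apply: double_root_sum => d _; apply: double_rootMl.
have [->|ce] := eqVneq c e; have [->|de] := eqVneq d e.
- rewrite /divdiff eqxx subrr mulr0 /double_root deriv0 !horner0 eqxx //.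
- rewrite (mulrC (nodal_except b e)) -mulrA; apply: double_rootM.
    by rewrite nodal_except_root // eq_sym.
  by rewrite !hornerE; ring.
- rewrite -mulrA; apply: double_rootM; first by rewrite nodal_except_root // eq_sym.
  rewrite hornerM; apply/eqP; rewrite mulf_eq0; apply/orP; right; apply/eqP.
  by have := divdiffM h c e; rewrite !hornerE; lra.
- rewrite [_ * _ * _]mulrC; apply: double_rootMl.
  by apply: double_rootM; rewrite nodal_except_root // eq_sym.
Qed.

End hermite.

(** Let S be the form on the left. The weights [x c * (a - c)] are chosen so that the error at a of
    the Hermite interpolation of q^2 f is S times the square of the nodal polynomial. Adding this
    multiple to the interpolant makes it exact at a as well, and Rolle applies to the difference. *)
Lemma remainder_form_hankel h b a (x : R -> R) :
  derivs I (size b).*2 h -> I a -> (forall c, c \in b -> I c) -> uniq (a :: b) ->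
  let q := nodal_comb b (fun c => x c * (a - c)) in
  exists2 z, I z & \sum_(c <- b) \sum_(d <- b) x c * x d * remainder h a c d =
    hankel_form h (size b) (fun i => (q^`N(size b - i.+1)).[z]) z.
Proof.
move=> dh Ia Ib uab q; set m := size b; set S := \sum_(c <- b) _.
have /andP[ab ub] : (a \notin b) && uniq b by [].
set w := fun c => x c * (a - c) in q *.
pose T : {poly R} := hermite h b w + S *: nodal b ^+ 2.
pose H k z := leibniz (q ^+ 2) h k z - (T^`(k)).[z].
have dH : derivs I m.*2 H.
  by apply: derivsB; [apply: derivs_leibniz|apply: derivs_poly].
have leib0 z : leibniz (q ^+ 2) h 0 z = q.[z] ^+ 2 * h 0%N z.
  by rewrite /leibniz big_ord1 derivn0 horner_exp subnn mulr1n.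
have leib1 z : leibniz (q ^+ 2) h 1 z =
    q.[z] ^+ 2 * h 1%N z + (q ^+ 2)^`().[z] * h 0%N z.
  rewrite /leibniz !big_ord_recl big_ord0 derivn0 [lift _ _ : nat]/= derivn1.
  rewrite horner_exp.
  by rewrite bin0 bin1 !mulr1n addr0 subn0 subnn.
have nodala c : c \in b -> (nodal b).[a] = (a - c) * (nodal_except b c).[a].
  by move=> cb; rewrite (nodalE ub cb) hornerM !hornerE.
have Ha : H 0%N a = 0.
  rewrite /H leib0 derivn0 /T hornerD hornerZ horner_exp.
  have qa : q.[a] = (nodal b).[a] * \sum_(c <- b) x c.
    rewrite /q /nodal_comb horner_sum big_distrr big_seq [RHS]big_seq.
    by apply: eq_bigr => c cb; rewrite hornerZ (nodala c cb) /w /=; ring.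
  have hermitea : (hermite h b w).[a] = (nodal b).[a] ^+ 2 *
      \sum_(c <- b) \sum_(d <- b)
        x c * x d * (h 0%N c + (a - c) * divdiff h c d).
    rewrite /hermite horner_sum big_distrr /= big_seq [RHS]big_seq.
    apply: eq_bigr => c cb.
    rewrite horner_sum big_distrr /= big_seq [RHS]big_seq; apply: eq_bigr => d db.
    rewrite !hornerE /= expr2 {1}(nodala c cb) (nodala d db) /w /=.
    by ring.
  have sumE : (\sum_(c <- b) x c) ^+ 2 * h 0%N a =
      \sum_(c <- b) \sum_(d <- b)
        x c * x d * (h 0%N c + (a - c) * divdiff h c d) + S.
    rewrite expr2 big_distrl /= big_distrl -big_split /=; apply: eq_bigr => c _.
    rewrite big_distrr big_distrl -big_split /=; apply: eq_bigr => d _.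
    by rewrite /remainder; ring.
  by rewrite hermitea qa exprMn -mulrA sumE; ring.
have Hb e : e \in b -> H 0%N e = 0 /\ H 1%N e = 0.
  move=> eb; have /andP[/eqP r0 /eqP r1] : double_root
      (T - q ^+ 2 * ((h 0%N e)%:P + h 1%N e *: ('X - e%:P))) e.
    rewrite /T addrAC; apply: double_rootD; first exact: hermite_double_root.
    rewrite -mul_polyC; apply: double_rootMl.
    by apply: double_rootM; rewrite (nodalE ub eb) hornerM !hornerE subrr mul0r.
  have tangent0 (U Q : {poly R}) u v :
      (U - Q * (u%:P + v *: ('X - e%:P))).[e] = U.[e] - Q.[e] * u.
    by rewrite !hornerE; ring.
  have tangent1 (U Q : {poly R}) u v :
      (U - Q * (u%:P + v *: ('X - e%:P)))^`().[e] =
      U^`().[e] - (Q^`().[e] * u + Q.[e] * v).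
    rewrite derivB derivM derivD derivZ derivB derivX !derivC.
    by rewrite !hornerE /= subrr !mulr0 subr0 mulr1 addr0.
  move: r0 r1; rewrite tangent0 tangent1 horner_exp => r0 r1.
  by rewrite /H leib0 leib1 derivn0 derivn1; split; lra.
have [z Iz Hz] := rolle_double itvI dH Ia Ib uab Ha Hb.
exists z => //; move: Hz; rewrite /H leibniz_sqr_hankel; last exact: size_nodal_comb.
have sn2 : size (nodal b ^+ 2) = m.*2.+1.
  by rewrite expr2 size_Mmonic ?monic_neq0 ?nodal_monic // !size_nodal -/m; lia.
have sT : (size T <= m.*2.+1)%N.
  apply: (leq_trans (size_polyD _ _)); rewrite geq_max leqW ?size_hermite //=.
  by rewrite (leq_trans (size_scale_leq _ _)) // sn2.
(* Only the square of the monic nodal polynomial reaches degree 2m, so the derivative of order 2m of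
   [T] is the constant (2m)! S. *)
rewrite derivn_size_leq // hornerC coefD coefZ nth_default ?size_hermite // add0r.
have -> : (nodal b ^+ 2)`_m.*2 = 1.
  have := monicP (monic_exp 2 (nodal_monic b)).
  by rewrite /lead_coef sn2.
have f0 : (m.*2`!%:R : R) != 0 by rewrite pnatr_eq0 -lt0n fact_gt0.
rewrite mulr1 -[S *+ _]mulr_natl => /eqP.
by rewrite subr_eq0 (inj_eq (mulfI f0)) => /eqP.
Qed.

End divided_differences.

(** * Signs of the remainder forms *)

Section remainder_forms.
Variables (R : realType) (I : set R).
Hypothesis itvI : is_interval I.
Implicit Types (h : nat -> R -> R) (q : {poly R}).

(** Serves when merging equal eigenvalues leaves fewer than n nodes. *)
Lemma hankel_form_widen h m n (u : nat -> R) t : (m <= n)%N ->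
  hankel_form h m u t = hankel_form h n (fun i => if (i < m)%N then u i else 0) t.
Proof.
move=> mn; rewrite /hankel_form.
rewrite (big_ord_widen n (fun i : nat => \sum_(j < m)
  u i * u j * (h (i.+1 + j.+1)%N t / (i.+1 + j.+1)`!%:R)) mn) big_mkcond.
apply: eq_bigr => i _; case: ifP => im; last first.
  by rewrite big1 // => j _; rewrite !mul0r.
rewrite (big_ord_widen n (fun j : nat =>
  u i * u j * (h (i.+1 + j.+1)%N t / (i.+1 + j.+1)`!%:R)) mn) big_mkcond.
by apply: eq_bigr => j _; case: ifP => // _; rewrite mulr0 mul0r.
Qed.

(** Nodes equal to a contribute nothing, and the coefficients at coinciding nodes add up; this
    reduces to distinct nodes different from a. *)
Lemma remainder_form_ge0 h n (a : R) (be x : 'I_n -> R) :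
  derivs I n.*2 h -> (forall t u, I t -> 0 <= hankel_form h n u t) ->
  I a -> (forall i, I (be i)) ->
  0 <= \sum_i \sum_j x i * x j * remainder h a (be i) (be j).
Proof.
move=> dh hpos Ia Ibe.
pose b := undup [seq be i | i <- enum 'I_n & be i != a].
have memb c : (c \in b) = (c != a) && [exists i, be i == c].
  rewrite mem_undup; apply/mapP/andP => [[i Hi ->] | [ca /existsP[i /eqP ic]]].
    move: Hi; rewrite mem_filter => /andP[ia _]; split=> //.
    by apply/existsP; exists i.
  by exists i => //; rewrite mem_filter mem_enum ic ca.
pose X c := \sum_(i | be i == c) x i.
have group (psi : R -> R) : psi a = 0 ->
    \sum_i x i * psi (be i) = \sum_(c <- b) X c * psi c.
  move=> psia; under [RHS]eq_bigr => c _.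
    rewrite /X big_distrl /= big_mkcond /=.
    over.
  rewrite exchange_big /=; apply: eq_bigr => i _.
  have [bia|bia] := eqVneq (be i) a.
    rewrite bia psia mulr0 big1_seq // => c /andP[_].
    by rewrite memb eq_sym => /andP[/negPf -> _].
  have bib : be i \in b by rewrite memb bia; apply/existsP; exists i.
  rewrite (bigD1_seq (be i)) ?undup_uniq //= eqxx big1 ?addr0 // => c /negPf cb.
  by rewrite eq_sym cb.
have mn : (size b <= n)%N.
  apply: (leq_trans (size_undup _)); rewrite size_map size_filter.
  by apply: (leq_trans (count_size _ _)); rewrite size_enum_ord.
have -> : \sum_i \sum_j x i * x j * remainder h a (be i) (be j) =
    \sum_(c <- b) \sum_(d <- b) X c * X d * remainder h a c d.
  pose psi c := \sum_(d <- b) X d * remainder h a c d.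
  have psia : psi a = 0.
    by rewrite /psi big1 // => d _; rewrite remainder_id mulr0.
  transitivity (\sum_i x i * psi (be i)).
    apply: eq_bigr => i _.
    rewrite /psi -(group (fun d => remainder h a (be i) d)).
      by rewrite big_distrr /=; apply: eq_bigr => j _; rewrite mulrA.
    by rewrite remainderC remainder_id.
  rewrite (group _ psia); apply: eq_bigr => c _; rewrite /psi big_distrr /=.
  by apply: eq_bigr => d _; rewrite mulrA.
have Ib c : c \in b -> I c by rewrite memb => /andP[_ /existsP[i /eqP <-]].
have uab : uniq (a :: b).
  by rewrite /= undup_uniq memb eqxx.
have dhb : derivs I (size b).*2 h by apply: derivs_le dh; rewrite leq_double.
have [z Iz ->] := remainder_form_hankel itvI X dhb Ia Ib uab.
by rewrite (hankel_form_widen _ _ _ mn); apply: hpos.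
Qed.

(** The condition on x makes the polynomial of [remainder_form_hankel] equal to the given q. Its
    right-hand side does not involve a, so one test vector will serve for all eigenvalues a. *)
Lemma remainder_form_lt0 h n q (a : R) (be x : 'I_n -> R) :
  derivs I n.*2 h -> (size q <= n)%N ->
  (forall z, I z -> hankel_form h n (fun i => (q^`N(n - i.+1)).[z]) z < 0) ->
  I a -> (forall i, I (be i)) -> injective be -> (forall i, be i != a) ->
  (forall i, x i * (a - be i) =
     q.[be i] / (nodal_except (codom be) (be i)).[be i]) ->
  \sum_i \sum_j x i * x j * remainder h a (be i) (be j) < 0.
Proof.
move=> dh sq hneg Ia Ibe ibe bea xE.
set b := codom be in xE.
pose X c := q.[c] / (nodal_except b c).[c] / (a - c).
have sb : size b = n by rewrite size_codom card_ord.
have ub : uniq b by apply/injectiveP.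
have ab : a \notin b.
  by apply/codomP => -[i ai]; have := bea i; rewrite ai eqxx.
have -> : \sum_i \sum_j x i * x j * remainder h a (be i) (be j) =
    \sum_(c <- b) \sum_(d <- b) X c * X d * remainder h a c d.
  have XE i : X (be i) = x i.
    by rewrite /X -xE mulfK // subr_eq0 eq_sym.
  rewrite /b /codom big_image /=; apply: eq_bigr => i _.
  by rewrite big_image /=; apply: eq_bigr => j _; rewrite !XE.
have [||||z Iz ->] := @remainder_form_hankel R I itvI h b a X.
- by rewrite sb.
- exact: Ia.
- by move=> c /codomP[i ->].
- by rewrite /= ab.
have -> : nodal_comb b (fun c => X c * (a - c)) = q.
  rewrite [RHS](@nodal_comb_interp _ b) ?sb // /nodal_comb big_seq [RHS]big_seq.
  apply: eq_bigr => c cb; rewrite /X divfK // subr_eq0.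
  by apply: contraNneq ab => ->.
by rewrite sb; apply: hneg.
Qed.

End remainder_forms.

(** * Hermitian forms, diagonalization and functional calculus *)

Section matrices.
Variable R : realType.
Local Notation C := R[i].
Implicit Types (h : nat -> R -> R).

Lemma conjCE (z : C) : Num.conj z = conjc z.
Proof. by []. Qed.

(** The cross terms between real and imaginary parts are antisymmetric in i and j and cancel, which
    reduces complex vectors to real ones. *)
Lemma sym_real_form n (x : 'I_n -> C) (M : 'I_n -> 'I_n -> R) :
  (forall i j, M i j = M j i) ->
  \sum_i \sum_j Num.conj (x i) * x j * (M i j)%:C =
  (\sum_i \sum_j complex.Re (x i) * complex.Re (x j) * M i j +
   \sum_i \sum_j complex.Im (x i) * complex.Im (x j) * M i j)%:C.
Proof.
move=> Msym.
pose re i := complex.Re (x i); pose im i := complex.Im (x i).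
transitivity (\sum_i \sum_j ((re i * re j * M i j + im i * im j * M i j)%:C +
    'i%C * (re i * im j * M i j - re j * im i * M j i)%:C)).
  apply: eq_bigr => i _; apply: eq_bigr => j _; rewrite conjCE /re /im Msym.
  case: (x i) => a b; case: (x j) => c d; apply/eqP; rewrite eq_complex /=.
  by apply/andP; split; apply/eqP; ring.
under eq_bigr do rewrite big_split /=.
rewrite big_split /= [X in _ + X](_ : _ = 0) ?addr0; last first.
  under eq_bigr do rewrite -big_distrr -rmorph_sum /= sumrB.
  rewrite -big_distrr -rmorph_sum /= sumrB [X in X - _]exchange_big subrr.
  by rewrite mulr0.
under eq_bigr do rewrite -rmorph_sum /= big_split /=.
by rewrite -rmorph_sum /= big_split.
Qed.

Lemma quad_form_unitary n (Q M : 'M[C]_n) (v : 'cV[C]_n) : Q \is unitarymx ->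
  (v^t* *m M *m v) 0 0 =
  \sum_i \sum_j Num.conj ((Q *m v) i 0) * (Q *m v) j 0 * (Q *m M *m Q^t*) i j.
Proof.
move=> Qu; set y := Q *m v.
have -> : v^t* *m M *m v = y^t* *m (Q *m M *m Q^t*) *m y.
  by rewrite /y trmx_mul map_mxM !mulmxA !mulmxKtV.
rewrite mxE exchange_big /=; apply: eq_bigr => j _.
rewrite mxE big_distrl /=; apply: eq_bigr => i _.
by rewrite !mxE mulrAC.
Qed.

Definition diagC n (d : 'I_n -> R) : 'M[C]_n := diag_mx (\row_k (d k)%:C).

(** For P unitary, the rows of P are left eigenvectors with eigenvalues d. *)
Definition udiag n (P : 'M[C]_n) (d : 'I_n -> R) : 'M[C]_n := P^t* *m diagC d *m P.

Lemma diagCE n (d : 'I_n -> R) i j : diagC d i j = (d i)%:C *+ (i == j).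
Proof. by rewrite !mxE. Qed.

Lemma mul_diagC n m (d : 'I_n -> R) (A : 'M[C]_(n, m)) k j :
  (diagC d *m A) k j = (d k)%:C * A k j.
Proof. by rewrite /diagC mul_diag_mx !mxE. Qed.

Lemma mul_mx_diagC n m (d : 'I_n -> R) (A : 'M[C]_(m, n)) k j :
  (A *m diagC d) k j = A k j * (d j)%:C.
Proof. by rewrite /diagC mul_mx_diag !mxE. Qed.

Lemma hermP n (A : 'M[C]_n) : reflect (A^t* = A) (A \is hermsymmx).
Proof.
apply: (iffP (is_hermitianmxP _ _ _)); rewrite expr0 scale1r => E.
  by rewrite -E.
by rewrite E.
Qed.

Lemma diagC_adj n (d : 'I_n -> R) : (diagC d)^t* = diagC d.
Proof.
apply/matrixP => i j; rewrite mxE [(_^T)%R _ _]mxE !diagCE eq_sym.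
case: eqVneq => [->|_]; last by rewrite !mulr0n rmorph0.
by rewrite !mulr1n conjCE conjc_real.
Qed.

Lemma udiag_adj n (P : 'M[C]_n) d : (udiag P d)^t* = udiag P d.
Proof. by rewrite /udiag !trmx_mul !map_mxM diagC_adj trmxCK mulmxA. Qed.

Lemma udiag_herm n (P : 'M[C]_n) d : udiag P d \is hermsymmx.
Proof. by apply/hermP/udiag_adj. Qed.

Lemma spectral_decomp n (f : R -> R) (A : 'M[C]_n) : A \is hermsymmx ->
  exists P d, [/\ P \is unitarymx, A = udiag P d, mxfun f A = udiag P (f \o d) &
    forall I, spectrum_in I A -> forall k, I (d k)].
Proof.
move=> Ah; set P := spectralmx A.
have Pu : P \is unitarymx by apply: spectral_unitarymx.
have /hermitian_normalmx/orthomx_spectralP AE := Ah.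
pose d k := complex.Re (spectral_diag A 0 k).
have dE k : spectral_diag A 0 k = (d k)%:C.
  by rewrite /d RRe_real //; apply/mxOverP/hermitian_spectral_diag_real.
have dgE : diag_mx (spectral_diag A) = diagC d.
  by rewrite /diagC; congr diag_mx; apply/rowP => k; rewrite mxE dE.
have fdE : diag_mx (map_mx (fun z : C => (f (complex.Re z))%:C) (spectral_diag A)) =
    diagC (f \o d).
  by rewrite /diagC; congr diag_mx; apply/rowP => k; rewrite !mxE.
exists P, d; split=> [//|||I As k].
- rewrite [LHS]AE -/P (invmx_unitary Pu) dgE /udiag; reflexivity.
- rewrite /mxfun -/P (invmx_unitary Pu) fdE /udiag; reflexivity.
- have [|x Ix dx] := As (d k)%:C; last by have -> : d k = x by case: dx.
  apply/eigenvalueP; exists (row k P).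
    rewrite [in LHS]AE -/P -row_mul !mulmxA mulmxV ?unitarymx_unit // mul1mx.
    by rewrite row_mul row_diag_mx -scalemxAl -rowE dE.
  apply/eqP => /(congr1 (fun r => r *m P^t*)).
  rewrite -row_mul (unitarymxP Pu) mul0mx => /rowP/(_ k).
  by rewrite !mxE eqxx => /eqP; rewrite oner_eq0.
Qed.

(** A diagonalizing P has [P k j] nonzero only where [be j = d k], hence it also intertwines the
    images of both diagonals under f. *)
Lemma mxfun_diag n (f : R -> R) (be : 'I_n -> R) :
  mxfun f (diagC be) = diagC (f \o be).
Proof.
have Ah : diagC be \is hermsymmx by apply/hermP/diagC_adj.
have [P [d [Pu AE -> _]]] := spectral_decomp f Ah.
have PE : P *m diagC be = diagC d *m P.
  by rewrite AE /udiag !mulmxA (unitarymxP Pu) mul1mx.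
have PfE : P *m diagC (f \o be) = diagC (f \o d) *m P.
  apply/matrixP => k j; have /matrixP/(_ k j) := PE.
  rewrite !mul_diagC !mul_mx_diagC => e.
  have /eqP : ((be j)%:C - (d k)%:C) * P k j = 0 by rewrite mulrBl -e mulrC subrr.
  rewrite mulf_eq0 => /orP[|/eqP ->]; last by rewrite mul0r mulr0.
  by rewrite subr_eq0 => /eqP/complexI /= ->; rewrite mulrC.
rewrite /udiag -mulmxA -PfE mulmxA.
by rewrite -[P^t* *m P]mul1mx mulmxA mulmxKtV // mul1mx.
Qed.

End matrices.

(** * Entrywise computations *)

Section matrix_entries.
Variables (K : nzRingType) (m n : nat).
Implicit Types (A B : 'M[K]_(m, n)).

Lemma scalemx_at (z : K) A i j : (z *: A) i j = z * A i j.
Proof. by rewrite mxE. Qed.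

Lemma addmx_at A B i j : (A + B) i j = A i j + B i j.
Proof. by rewrite mxE. Qed.

Lemma oppmx_at A i j : (- A) i j = - A i j.
Proof. by rewrite mxE. Qed.

End matrix_entries.

Section conjmx.
Variables (K : comNzRingType) (n : nat).
Implicit Types (P Q A B : 'M[K]_n).

Lemma conjmx_comb P Q A B (s t : K) i j :
  (P *m (s *: A + t *: B) *m Q) i j = s * (P *m A *m Q) i j + t * (P *m B *m Q) i j.
Proof. by rewrite mulmxDr mulmxDl -!scalemxAr -!scalemxAl addmx_at !scalemx_at. Qed.

Lemma conjmxB P Q A B i j :
  (P *m (A - B) *m Q) i j = (P *m A *m Q) i j - (P *m B *m Q) i j.
Proof. by rewrite mulmxBr mulmxBl addmx_at oppmx_at. Qed.

End conjmx.

(** The multiples of g cancel because the weighted deviations of u1 and u2 from their mean add up to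
    zero. *)
Lemma affine_gap (K : comNzRingType) (l z f1 f2 f0 g u1 u2 : K) :
  z * (l * f1 + (1 - l) * f2 - f0) =
  l * (z * (f1 - f0 - g * (u1 - (l * u1 + (1 - l) * u2)))) +
  (1 - l) * (z * (f2 - f0 - g * (u2 - (l * u1 + (1 - l) * u2)))).
Proof. by ring. Qed.

(** * Numerical range and spectra of combinations *)

Section numerical_range.
Variable R : realType.
Local Notation C := R[i].

(** This is lo <= M <= hi in the Loewner order; unlike individual eigenvalues, such bounds combine
    linearly. *)
Definition num_range_in n (lo hi : R) (M : 'M[C]_n) :=
  forall w : 'rV[C]_n, lo%:C * (w *m w^t*) 0 0 <= (w *m M *m w^t*) 0 0 <=
                       hi%:C * (w *m w^t*) 0 0.

Lemma num_range_spectrum n lo hi (M : 'M[C]_n) :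
  num_range_in lo hi M -> spectrum_in [set x | lo <= x <= hi] M.
Proof.
move=> Mr z /eigenvalueP[w wM w0]; have := Mr w.
have ww : 0 < (w *m w^t*) 0 0 by rewrite -dotmxE dotmx_is_dotmx.
rewrite wM -scalemxAl scalemx_at !ler_pM2r // => /andP[loz zhi].
have zE : z = (complex.Re z)%:C.
  (* Comparable complex numbers have the same imaginary part, so the lower bound also makes z
     real. *)
  move: loz; rewrite lecE /= => /andP[/eqP im0 _].
  by case: z im0 {wM zhi} => [x y] /= ->.
exists (complex.Re z) => //=; move: loz zhi; rewrite zE /= !lecR => -> ->.
by [].
Qed.

Lemma num_range_udiag n lo hi (P : 'M[C]_n) d : P \is unitarymx ->
  (forall k, lo <= d k <= hi) -> num_range_in lo hi (udiag P d).
Proof.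
move=> Pu dk w; pose u := w *m P^t*.
have -> : w *m w^t* = u *m u^t*.
  by rewrite /u trmx_mul map_mxM trmxCK mulmxA mulmxKtV.
have -> : w *m udiag P d *m w^t* = u *m diagC d *m u^t*.
  by rewrite /u /udiag trmx_mul map_mxM trmxCK !mulmxA.
clearbody u; rewrite !mxE !big_distrr /=; apply/andP.
by split; apply: ler_sum => k _; rewrite mul_mx_diagC !mxE [u 0 k * _ * _]mulrAC
  [_ * (d k)%:C]mulrC ler_wpM2r ?mul_conjC_ge0 // lecR; have /andP[] := dk k.
Qed.

Lemma num_range_comb n (s t lo1 hi1 lo2 hi2 : R) (A B : 'M[C]_n) :
  0 <= s -> 0 <= t -> num_range_in lo1 hi1 A -> num_range_in lo2 hi2 B ->
  num_range_in (s * lo1 + t * lo2) (s * hi1 + t * hi2) (s%:C *: A + t%:C *: B).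
Proof.
move=> s0 t0 Ar Br w.
have /andP[a1 a2] := Ar w; have /andP[b1 b2] := Br w.
rewrite mulmxDr mulmxDl -!scalemxAr -!scalemxAl addmx_at !scalemx_at.
rewrite !rmorphD !rmorphM /= !mulrDl -!mulrA.
by apply/andP; split; apply: lerD; rewrite ler_wpM2l // ler0c.
Qed.

Lemma finite_bounds n (I : set R) (d : 'I_n -> R) : (0 < n)%N ->
  (forall k, I (d k)) -> exists lo hi, [/\ I lo, I hi & forall k, lo <= d k <= hi].
Proof.
case: n d => // n d _ Id.
pose i0 : 'I_n.+1 := ord0.
exists (d [arg min_(i < i0) d i]%O), (d [arg max_(i > i0) d i]%O); split=> // k.
by apply/andP; split; [case: arg_minP|case: arg_maxP] => // i _; apply.
Qed.

(** The extreme eigenvalues of A and B lie in I and bound the two matrices; the combination is then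
    bounded by the smallest and the largest of these four numbers. *)
Lemma spectrum_in_convex n (I : set R) (A B : 'M[C]_n) (l : R) :
  is_interval I -> (0 < n)%N -> A \is hermsymmx -> B \is hermsymmx ->
  spectrum_in I A -> spectrum_in I B -> 0 <= l <= 1 ->
  spectrum_in I (l%:C *: A + (1 - l)%:C *: B).
Proof.
move=> itvI n0 Ah Bh As Bs /andP[l0 l1].
have bounds (M : 'M[C]_n) : M \is hermsymmx -> spectrum_in I M ->
    exists lo hi, [/\ I lo, I hi & num_range_in lo hi M].
  move=> Mh Ms; have [P [d [Pu ME _ dM]]] := spectral_decomp id Mh; rewrite ME.
  have [|lo [hi [Ilo Ihi dk]]] := @finite_bounds n I d n0.
    exact: dM Ms.
  by exists lo, hi; split=> //; apply: num_range_udiag.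
have [lo1 [hi1 [Ilo1 Ihi1 A1]]] := bounds A Ah As.
have [lo2 [hi2 [Ilo2 Ihi2 B2]]] := bounds B Bh Bs.
have l1' : 0 <= 1 - l by rewrite subr_ge0.
move=> z /(num_range_spectrum (num_range_comb l0 l1' A1 B2)) [x /= /andP[x1 x2] ->].
exists x => //.
apply: (itvI (Num.min lo1 lo2) (Num.max hi1 hi2)).
- by rewrite /Num.min; case: ifP.
- by rewrite /Num.max; case: ifP.
apply/andP; split.
  apply: le_trans x1; rewrite -[leLHS]mul1r -[in leLHS](subrKC l 1) mulrDl.
  by apply: lerD; rewrite ler_wpM2l // ge_min lexx ?orbT.
apply: le_trans x2 _; rewrite -[leRHS]mul1r -[in leRHS](subrKC l 1) [leRHS]mulrDl.
by apply: lerD; rewrite ler_wpM2l // le_max lexx ?orbT.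
Qed.

End numerical_range.

(** * The convexity gap as a sum of remainder forms *)

Section convexity_gap.
Variable R : realType.
Local Notation C := R[i].
Variables (n : nat) (h : nat -> R -> R) (be : 'I_n -> R).
Implicit Types (c P Q : 'M[C]_n) (al : 'I_n -> R).

(** The share of the k-th eigenvector of A: [c] is the transition matrix between the eigenbases of M
    and A, and [y] is the test vector in the eigenbasis of M. *)
Definition remainder_term c al (y : 'cV[C]_n) k : C :=
  \sum_i \sum_j Num.conj (c k i * y i 0) * (c k j * y j 0) *
    (remainder h (al k) (be i) (be j))%:C.

Lemma udiagE c al i j :
  udiag c al i j = \sum_k Num.conj (c k i) * c k j * (al k)%:C.
Proof.
rewrite /udiag mxE; apply: eq_bigr => k _.
by rewrite mul_mx_diagC !mxE mulrAC.
Qed.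

Lemma udiag_conj P Q al : Q *m udiag P al *m Q^t* = udiag (P *m Q^t*) al.
Proof. by rewrite /udiag trmx_mul map_mxM trmxCK !mulmxA. Qed.

(** Orthonormality of the columns of c turns the diagonal matrices attached to M into sums over k as
    well. *)
Lemma sum_remainder_term c al y : c \is unitarymx ->
  \sum_k remainder_term c al y k =
  \sum_i \sum_j Num.conj (y i 0) * y j 0 *
    (udiag c (h 0%N \o al) i j - diagC (h 0%N \o be) i j -
     (divdiff h (be i) (be j))%:C * (udiag c al i j - diagC be i j)).
Proof.
move=> cu; rewrite /remainder_term exchange_big /=; apply: eq_bigr => i _.
rewrite exchange_big /=; apply: eq_bigr => j _.
have ortho d : diagC d i j = \sum_k Num.conj (c k i) * c k j * (d i)%:C.
  have cc : c^t* *m c = 1%:M.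
    by rewrite -[_ *m c]mul1mx mulmxA mulmxKtV.
  rewrite -big_distrl /= diagCE -mulr_natr mulrC; congr (_ * _).
  have /matrixP/(_ i j) := cc; rewrite !mxE => <-.
  by apply: eq_bigr => k _; rewrite !mxE.
rewrite !udiagE !ortho -!sumrB !big_distrr -sumrB big_distrr /=.
apply: eq_bigr => k _.
by rewrite /remainder !rmorphM !rmorphB rmorphM !rmorphB /=; ring.
Qed.

Lemma convexity_gap (P1 P2 Q : 'M[C]_n) a1 a2 (l : R) (v : 'cV[C]_n) :
  P1 \is unitarymx -> P2 \is unitarymx -> Q \is unitarymx ->
  udiag Q be = l%:C *: udiag P1 a1 + (1 - l)%:C *: udiag P2 a2 ->
  (v^t* *m (l%:C *: udiag P1 (h 0%N \o a1) + (1 - l)%:C *: udiag P2 (h 0%N \o a2) -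
            udiag Q (h 0%N \o be)) *m v) 0 0 =
  l%:C * \sum_k remainder_term (P1 *m Q^t*) a1 (Q *m v) k +
  (1 - l)%:C * \sum_k remainder_term (P2 *m Q^t*) a2 (Q *m v) k.
Proof.
move=> P1u P2u Qu CE; rewrite (quad_form_unitary _ _ Qu).
have Qtu : Q^t* \is unitarymx by rewrite trmxC_unitary.
have diagQ d : Q *m udiag Q d *m Q^t* = diagC d.
  rewrite udiag_conj (unitarymxP Qu) /udiag mulmx1.
  by rewrite trmx1 map_mx1 mul1mx.
have c1u : P1 *m Q^t* \is unitarymx by exact: (mul_unitarymx P1u Qtu).
have c2u : P2 *m Q^t* \is unitarymx by exact: (mul_unitarymx P2u Qtu).
rewrite (sum_remainder_term _ _ c1u) (sum_remainder_term _ _ c2u).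
rewrite !big_distrr -big_split /=.
apply: eq_bigr => i _; rewrite !big_distrr -big_split /=; apply: eq_bigr => j _.
have bE := congr1 (fun N => (Q *m N *m Q^t*) i j) CE.
rewrite /= conjmx_comb diagQ !udiag_conj in bE.
rewrite conjmxB conjmx_comb diagQ !udiag_conj bE rmorphB rmorph1.
exact: affine_gap.
Qed.

End convexity_gap.

(** * Rank one perturbations of a diagonal matrix *)

(** Cauchy-Schwarz against the all-ones vector: twice the difference is the sum of all |w_k -
    w_l|^2. *)
Lemma norm_sum_sqr_le (K : numClosedFieldType) n (w : 'I_n -> K) :
  (\sum_k w k) * Num.conj (\sum_k w k) <= n%:R * \sum_k w k * Num.conj (w k).
Proof.
rewrite -subr_ge0 -(pmulr_rge0 _ (ltr0n K 2)).
have -> : 2 * (n%:R * (\sum_k w k * Num.conj (w k)) -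
               (\sum_k w k) * Num.conj (\sum_k w k)) =
    \sum_k \sum_l (w k - w l) * Num.conj (w k - w l).
  pose N := \sum_k w k * Num.conj (w k).
  have e1 : \sum_(k < n) \sum_(l < n) w l * Num.conj (w l) = n%:R * N.
    by rewrite sumr_const card_ord mulr_natl.
  have e2 : \sum_(k < n) \sum_(l < n) w k * Num.conj (w k) = n%:R * N.
    by rewrite exchange_big /= sumr_const card_ord mulr_natl.
  have e3 : \sum_(k < n) \sum_(l < n) w k * Num.conj (w l) =
      (\sum_k w k) * Num.conj (\sum_k w k).
    rewrite rmorph_sum big_distrl /=; apply: eq_bigr => k _.
    by rewrite big_distrr.
  have e4 : \sum_(k < n) \sum_(l < n) w l * Num.conj (w k) =
      (\sum_k w k) * Num.conj (\sum_k w k).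
    by rewrite exchange_big.
  have -> : \sum_k \sum_l (w k - w l) * Num.conj (w k - w l) =
      \sum_(k < n) \sum_(l < n) w k * Num.conj (w k) +
      \sum_(k < n) \sum_(l < n) w l * Num.conj (w l) -
      \sum_(k < n) \sum_(l < n) w k * Num.conj (w l) -
      \sum_(k < n) \sum_(l < n) w l * Num.conj (w k).
    rewrite -big_split -!sumrB /=; apply: eq_bigr => k _.
    rewrite -big_split -!sumrB /=; apply: eq_bigr => l _.
    by rewrite rmorphB /=; ring.
  by rewrite e1 e2 e3 e4 -/N; ring.
by apply: sumr_ge0 => k _; apply: sumr_ge0 => l _; apply: mul_conjC_ge0.
Qed.

Section necessity.
Variables (R : realType) (n : nat).
Local Notation C := R[i].
Hypothesis n_gt0 : (0 < n)%N.

Lemma num_range_ones (e : R) :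
  num_range_in (- (`|e| * n%:R)) (`|e| * n%:R) (e%:C *: const_mx 1 : 'M[C]_n).
Proof.
move=> w; pose s := \sum_k w 0 k; pose N := \sum_k w 0 k * Num.conj (w 0 k).
have -> : (w *m w^t*) 0 0 = N.
  by rewrite mxE; apply: eq_bigr => k _; rewrite !mxE.
have -> : (w *m (e%:C *: const_mx 1) *m w^t*) 0 0 = e%:C * (s * Num.conj s).
  rewrite -scalemxAr -scalemxAl scalemx_at mxE; congr (_ * _).
  rewrite /s rmorph_sum big_distrr /=; apply: eq_bigr => k _.
  by rewrite !mxE; congr (_ * _); apply: eq_bigr => j _; rewrite mxE mulr1.
have sN : s * Num.conj s <= n%:R * N := norm_sum_sqr_le (w 0).
have ss0 : 0 <= s * Num.conj s := mul_conjC_ge0 s.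
have bound : `|e|%:C * (s * Num.conj s) <= (`|e| * n%:R)%:C * N.
  rewrite rmorphM /= rmorph_nat -mulrA ler_wpM2l // ler0c //.
apply/andP; split.
  rewrite rmorphN mulNr lerNl; apply: le_trans bound.
  by rewrite -mulNr ler_wpM2r // -rmorphN lecR -normrN ler_norm.
by apply: le_trans bound; rewrite ler_wpM2r // lecR ler_norm.
Qed.

Variables (h : nat -> R -> R) (be : 'I_n -> R) (w : 'I_n -> R).
Variable J : set R.
Hypothesis be_inj : injective be.
Hypothesis form_lt0 : forall a x, J a -> (forall i, be i != a) ->
  (forall i, x i * (a - be i) = w i) ->
  \sum_i \sum_j x i * x j * remainder h a (be i) (be j) < 0.

(** Let s be the sum of row k of P. The eigenvector equation reads (al_k - be_j) P_kj = e s for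
    every j, hence P_kj w_j = e s x_j with x_j = w_j / (al_k - be_j), to which [form_lt0]
    applies. *)
Lemma remainder_term_perturb (e : R) (P : 'M[C]_n) al k : e != 0 -> J (al k) ->
  P *m (diagC be + e%:C *: const_mx 1) = diagC al *m P ->
  exists2 r, r < 0 & remainder_term h be P al (\col_i (w i)%:C) k =
    ((\sum_l P k l) * Num.conj (\sum_l P k l)) * r%:C.
Proof.
move=> e0 Jk PE; set s := \sum_l P k l.
have ec0 : e%:C != 0 :> C by apply: contra_neq e0 => /complexI.
have Ps j : e%:C * s = ((al k)%:C - (be j)%:C) * P k j.
  have := congr1 (fun M : 'M[C]_n => M k j) PE.
  rewrite /= mulmxDr addmx_at mul_mx_diagC mul_diagC -scalemxAr scalemx_at.
  have -> : (P *m const_mx 1) k j = s.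
    by rewrite mxE; apply: eq_bigr => l _; rewrite mxE mulr1.
  by move=> E; rewrite mulrBl -E (mulrC (P k j)) addrC addKr.
clearbody s.
case: (boolP [exists j, be j == al k]) => [/existsP[j0 /eqP bj0]|].
  have s0 : s = 0.
    by apply/(mulfI ec0); rewrite mulr0 (Ps j0) bj0 subrr mul0r.
  (* Here s = 0 and the term vanishes, so any negative r will do. *)
  exists (-1); first by rewrite oppr_lt0 ltr01.
  rewrite s0 !mul0r /remainder_term big1 // => i _; rewrite big1 // => j _.
  have := Ps i; rewrite s0 mulr0 => /esym/eqP; rewrite mulf_eq0 => /orP[|/eqP->].
    rewrite subr_eq0 => /eqP/complexI ->.
    by rewrite remainder_id mulr0.
  by rewrite mul0r rmorph0 !mul0r.
rewrite negb_exists => /forallP bal.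
have d0 i : al k - be i != 0 by rewrite subr_eq0 eq_sym.
pose x i := w i / (al k - be i).
have xE i : x i * (al k - be i) = w i by rewrite /x divfK.
exists (e ^+ 2 * \sum_i \sum_j x i * x j * remainder h (al k) (be i) (be j)).
  by rewrite pmulr_rlt0 ?form_lt0 // exprn_even_gt0.
have cy i : P k i * (\col_i (w i)%:C) i 0 = (e%:C * s) * (x i)%:C.
  rewrite mxE (Ps i) -xE rmorphM rmorphB /=; ring.
rewrite /remainder_term rmorphM /= rmorph_sum mulrA big_distrr /=.
apply: eq_bigr => i _; rewrite rmorph_sum big_distrr /=; apply: eq_bigr => j _.
rewrite !cy !rmorphM /= !conjCE !conjc_real; ring.
Qed.

Lemma sum_remainder_term_lt0 (e : R) (P : 'M[C]_n) al : e != 0 ->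
  (forall k, J (al k)) -> P \is unitarymx ->
  P *m (diagC be + e%:C *: const_mx 1) = diagC al *m P ->
  \sum_k remainder_term h be P al (\col_i (w i)%:C) k < 0.
Proof.
move=> e0 Jal Pu PE.
have term k := remainder_term_perturb e0 (Jal k) PE.
(* Otherwise the invertible P would send the all-ones vector to 0. *)
have [k0 sk0] : exists k, \sum_l P k l != 0.
  apply: contrapT => /forallNP s0.
  have P1 : P *m const_mx 1 = 0 :> 'cV[C]_n.
    apply/matrixP => k j; have /negP/negPn/eqP sk := s0 k.
    rewrite mxE [RHS]mxE -[RHS]sk.
    by apply: eq_bigr => l _; rewrite mxE mulr1.
  have /(congr1 (mulmx (invmx P))) := P1.
  rewrite mulKmx ?unitarymx_unit // mulmx0 => /matrixP/(_ (Ordinal n_gt0) 0).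
  by rewrite !mxE => /eqP; rewrite oner_eq0.
rewrite (bigD1 k0) //=.
have [r r0 ->] := term k0.
rewrite -[X in _ < X]addr0; apply: ltr_leD.
  by rewrite pmulr_rlt0 ?ltcR // mul_conjC_gt0.
apply: sumr_le0 => k _; have [r' r'0 ->] := term k.
by rewrite mulr_ge0_le0 ?mul_conjC_ge0 // lecR ltW.
Qed.

End necessity.

(** * Nonnegative Hankel forms imply matrix convexity *)

Section sufficiency.
Variable R : realType.
Local Notation C := R[i].

Lemma open_itv_is_interval (a b : \bar R) : is_interval (open_itv a b).
Proof.
move=> x y /andP[ax _] /andP[_ yb] z /andP[xz zy]; apply/andP; split.
  by apply: lt_le_trans ax _; rewrite lee_fin.
by apply: le_lt_trans yb; rewrite lee_fin.
Qed.

Lemma open_itv_nbhs (a b : \bar R) (t : R) :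
  open_itv a b t -> \forall z \near t, open_itv a b z.
Proof.
move=> /andP[at_ tb]; near=> z; apply/andP; split; near: z.
  case: a at_ => [r| |] //; last by move=> _; apply: nearW => z; rewrite ltNyr.
  by rewrite lte_fin => rt; near do rewrite lte_fin; apply: lt_nbhsr.
case: b tb => [r| |] //; last by move=> _; apply: nearW => z; rewrite ltry.
by rewrite lte_fin => rt; near do rewrite lte_fin; apply: lt_nbhsl.
Unshelve. all: by end_near. Qed.

Lemma Cn_on_derivs m (I : set R) (f : R -> R) :
  Cn_on m I f -> derivs I m (fun k => derive1n k f).
Proof.
move=> [df _] k x km Ix; apply: DeriveDef; first exact: df.
by rewrite derive1nS derive1E.
Qed.

Lemma Cn_on_continuous m (I : set R) (f : R -> R) k (x : R) :
  Cn_on m I f -> (k <= m)%N -> I x -> derive1n k f z @[z --> x] --> derive1n k f x.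
Proof.
move=> [df cf]; rewrite leq_eqVlt => /predU1P[->|km] Ix; first exact: cf.
by apply: differentiable_continuous; apply/derivable1_diffP; apply: df.
Qed.

Lemma herm_comb n (s t : R) (A B D : 'M[C]_n) :
  A \is hermsymmx -> B \is hermsymmx -> D \is hermsymmx ->
  s%:C *: A + t%:C *: B - D \is hermsymmx.
Proof.
move=> /hermP Ah /hermP Bh /hermP Dh; apply/hermP/matrixP => i j.
have e (M : 'M[C]_n) : M^t* = M -> Num.conj (M j i) = M i j.
  by move=> Me; rewrite -[in RHS]Me !mxE.
rewrite mxE [(_^T)%R i j]mxE !addmx_at !oppmx_at !scalemx_at.
rewrite rmorphB rmorphD !rmorphM /= (e _ Ah) (e _ Bh) (e _ Dh).
by rewrite !conjCE !conjc_real.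
Qed.

Lemma matrix_convex_of_hankel n (a b : \bar R) (f : R -> R) : (0 < n)%N ->
  derivs (open_itv a b) n.*2 (fun k => derive1n k f) ->
  (forall t u, open_itv a b t -> 0 <= hankel_form (fun k => derive1n k f) n u t) ->
  matrix_convex n (open_itv a b) f.
Proof.
move=> n0 df hpos A B l Ah Bh As Bs l01.
have itvI : is_interval (open_itv a b) := @open_itv_is_interval a b.
set M := l%:C *: A + (1 - l)%:C *: B.
have Ms : spectrum_in (open_itv a b) M := spectrum_in_convex itvI n0 Ah Bh As Bs l01.
have Mh : M \is hermsymmx.
  have := herm_comb l (1 - l) Ah Bh (udiag_herm 0 (fun=> 0)).
  by rewrite /udiag mulmx0 subr0.
have [P1 [a1 [P1u AE FA da1]]] := spectral_decomp f Ah.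
have [P2 [a2 [P2u BE FB da2]]] := spectral_decomp f Bh.
have [Q [be [Qu ME FM dbe]]] := spectral_decomp f Mh.
rewrite /loewner_le FA FB FM.
split; first by apply: herm_comb; apply: udiag_herm.
have qdE : udiag Q be = l%:C *: udiag P1 a1 + (1 - l)%:C *: udiag P2 a2.
  by rewrite -ME -AE -BE.
have term_ge0 c al y k : open_itv a b (al k) ->
    0 <= remainder_term (fun k => derive1n k f) be c al y k.
  move=> Ial; rewrite /remainder_term.
  rewrite (sym_real_form (fun i => c k i * y i 0)) => [|i j]; last exact: remainderC.
  rewrite ler0c; apply: addr_ge0; apply: (remainder_form_ge0 itvI) => // i;
    exact: dbe.
move=> v; have := convexity_gap (fun k => derive1n k f) v P1u P2u Qu qdE.
rewrite /= => ->; have /andP[l0 l1] := l01.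
apply: addr_ge0; apply: mulr_ge0; rewrite ?ler0c ?subr_ge0 //;
  apply: sumr_ge0 => k _;
  apply: term_ge0; [exact: da1|exact: da2].
Qed.

End sufficiency.

(** * Matrix convexity implies nonnegative Hankel forms *)

Lemma midpoint (K : nzRingType) (V : lmodType K) (x y : V) (s : K) :
  s + s = 1 -> x = s *: (x + y) + s *: (x - y).
Proof.
by move=> s1; rewrite -scalerDr addrACA subrr addr0 scalerDr -scalerDl s1 scale1r.
Qed.

Section hankel_of_matrix_convex.
Variable R : realType.
Local Notation C := R[i].

Lemma udiag1 n (d : 'I_n -> R) : udiag 1%:M d = diagC d.
Proof. by rewrite /udiag mulmx1 trmx1 map_mx1 mul1mx. Qed.

Lemma hankel_form_near n (h : nat -> R -> R) (q : {poly R}) (t : R) :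
  (forall k, (k <= n.*2)%N -> h k z @[z --> t] --> h k t) ->
  hankel_form h n (fun i => (q^`N(n - i.+1)).[t]) t < 0 ->
  \forall z \near t, hankel_form h n (fun i => (q^`N(n - i.+1)).[z]) z < 0.
Proof.
move=> hc neg.
suff : hankel_form h n (fun i => (q^`N(n - i.+1)).[z]) z @[z --> t] -->
       hankel_form h n (fun i => (q^`N(n - i.+1)).[t]) t.
  by move/cvgr_lt; apply.
rewrite /hankel_form; apply: cvg_big => [|i _]; first exact: add_continuous.
apply: cvg_big => [|j _]; first exact: add_continuous.
apply: cvgM; first by apply: cvgM; apply: continuous_horner.
apply: cvgM; last exact: cvg_cst.
by apply: hc; have := ltn_ord i; have := ltn_ord j; lia.
Qed.

Lemma taylor_poly_exists n (u : nat -> R) (t : R) : exists2 q : {poly R},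
  (size q <= n)%N & forall i, (i < n)%N -> (q^`N(n - i.+1)).[t] = u i.
Proof.
pose q0 : {poly R} := \poly_(k < n) u (n - k.+1)%N.
exists (q0 \Po ('X - t%:P)).
  by rewrite size_comp_poly2 ?size_poly // size_XsubC.
move=> i ilt; rewrite -coef_comp_XaddC -comp_polyA.
rewrite comp_polyB comp_polyX comp_polyC addrK comp_polyXr coef_poly.
have -> : (n - i.+1 < n)%N by lia.
by congr u; lia.
Qed.

Lemma hankel_form_ge0 n (a b : \bar R) (f : R -> R) (u : nat -> R) (t : R) :
  (0 < n)%N -> Cn_on n.*2 (open_itv a b) f ->
  matrix_convex n (open_itv a b) f -> open_itv a b t ->
  0 <= hankel_form (fun k => derive1n k f) n u t.
Proof.
move=> n0 fC fconv It; rewrite leNgt; apply/negP => neg.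
set h := (fun k => derive1n k f) in neg.
have [q sq qE] := taylor_poly_exists n u t.
have hE : hankel_form h n (fun i => (q^`N(n - i.+1)).[t]) t = hankel_form h n u t.
  by apply: eq_bigr => i _; apply: eq_bigr => j _; rewrite !qE.
rewrite -hE in neg.
have near_neg := hankel_form_near (fun k kn => Cn_on_continuous fC kn It) neg.
have [e /= e0 be] := (nbhs_ballP _ _).1 (filterI near_neg (open_itv_nbhs It)).
pose J := [set z | t - e / 2 <= z <= t + e / 2].
have JP z : J z ->
    hankel_form h n (fun i => (q^`N(n - i.+1)).[z]) z < 0 /\ open_itv a b z.
  move=> /andP[z1 z2]; apply: be; rewrite /ball /= distrC ltr_distl.
  by apply/andP; split; lra.
have itvJ : is_interval J.
  move=> x y /andP[x1 x2] /andP[y1 y2] z /andP[xz zy]; apply/andP; split; lra.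
have nR0 : 0 < n%:R :> R by rewrite ltr0n.
(* The nodes will lie in [t, t + e/4], and [de] times the all-ones matrix moves the spectrum by at
   most de n = e/4, so all spectra stay in J. *)
pose de : R := e / 4 / n%:R.
have de0 : 0 < de by rewrite !divr_gt0.
have den : de * n%:R = e / 4 by rewrite /de divfK ?gt_eqF.
pose bet (i : 'I_n) : R := t + de * i%:R.
have bet_inj : injective bet.
  move=> i j /addrI/(mulfI (negbT (gt_eqF de0)))/eqP.
  by rewrite eqr_nat => /eqP/val_inj.
have betJ i : t - e / 4 <= bet i <= t + e / 4.
  have i0 : 0 <= de * i%:R by rewrite mulr_ge0 // ltW.
  have i1 : de * i%:R <= e / 4 by rewrite -den ler_pM2l // ler_nat ltnW.
  by rewrite /bet; apply/andP; split; lra.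
have Jbet i : J (bet i).
  by have /andP[b1 b2] := betJ i; apply/andP; split; lra.
have dh : derivs J n.*2 h.
  by move=> k x kn /JP[_ Ix]; apply: (Cn_on_derivs fC).
(* The test vector: it makes q the polynomial of the remainder form for every eigenvalue of both
   perturbations. *)
pose w i := q.[bet i] / (nodal_except (codom bet) (bet i)).[bet i].
have form_lt0 a' x : J a' -> (forall i, bet i != a') ->
    (forall i, x i * (a' - bet i) = w i) ->
    \sum_i \sum_j x i * x j * remainder h a' (bet i) (bet j) < 0.
  move=> Ja' bea xE; apply: (remainder_form_lt0 itvJ dh sq) => // z /JP[] //.
pose A (s : R) : 'M[C]_n := diagC bet + s%:C *: const_mx 1.
have A_range s : `|s| = de -> spectrum_in J (A s).
  move=> sde.
  have r1 : num_range_in (t - e / 4) (t + e / 4) (diagC bet).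
    rewrite -udiag1; apply: num_range_udiag => //.
    by apply/unitarymxP; rewrite trmx1 map_mx1 mul1mx.
  have r2 := @num_range_ones R n s.
  have := num_range_spectrum (num_range_comb ler01 ler01 r1 r2).
  rewrite !mul1r rmorph1 !scale1r sde den => sp z /sp[x /= /andP[x1 x2] ->].
  by exists x => //; apply/andP; split; lra.
have A_herm s : A s \is hermsymmx.
  have Jh : (const_mx 1 : 'M[C]_n) \is hermsymmx.
    by apply/hermP/matrixP => i j; rewrite !mxE rmorph1.
  have := herm_comb 1 s (udiag_herm 1%:M bet) Jh (udiag_herm 0 bet).
  by rewrite /udiag mulmx0 subr0 -/(udiag _ _) udiag1 rmorph1 scale1r.
have sub_itv s : `|s| = de -> spectrum_in (open_itv a b) (A s).
  by move=> /A_range sp z /sp[x /JP[_ Ix] ->]; exists x.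
pose l : R := 2^-1.
have l01 : 0 <= l <= 1 by rewrite /l invr_ge0 ler0n invf_le1 // ler1n.
have ME : diagC bet = l%:C *: A de + (1 - l)%:C *: A (- de).
  have -> : 1 - l = l by rewrite /l; lra.
  rewrite /A rmorphN scaleNr; apply: midpoint.
  by rewrite -rmorphD -(rmorph1 (real_complex R)); congr (_ %:C); rewrite /l; lra.
have sde1 : `|de| = de by rewrite gtr0_norm.
have sde2 : `|- de| = de by rewrite normrN.
have [P1 [a1 [P1u A1E F1 da1]]] := spectral_decomp f (A_herm de).
have [P2 [a2 [P2u A2E F2 da2]]] := spectral_decomp f (A_herm (- de)).
have Q1 : (1%:M : 'M[C]_n) \is unitarymx.
  by apply/unitarymxP; rewrite trmx1 map_mx1 mul1mx.
have [_] := fconv _ _ l (A_herm de) (A_herm (- de)) (sub_itv _ sde1)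
  (sub_itv _ sde2) l01.
rewrite -ME mxfun_diag F1 F2 -udiag1 => /(_ (\col_i (w i)%:C)).
have qdE : udiag 1%:M bet = l%:C *: udiag P1 a1 + (1 - l)%:C *: udiag P2 a2.
  by rewrite udiag1 -A1E -A2E.
have -> := convexity_gap h (\col_i (w i)%:C) P1u P2u Q1 qdE.
rewrite trmx1 map_mx1 !mulmx1 mul1mx.
have intertwine s P al : P \is unitarymx -> A s = udiag P al ->
    P *m A s = diagC al *m P.
  move=> Pu ->; rewrite /udiag !mulmxA (unitarymxP Pu) mul1mx //.
have neg_de : - de != 0 by rewrite oppr_eq0 gt_eqF.
have pos_de : de != 0 by rewrite gt_eqF.
have T1 := sum_remainder_term_lt0 n0 form_lt0 pos_de (da1 _ (A_range _ sde1))
  P1u (intertwine _ _ _ P1u A1E).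
have T2 := sum_remainder_term_lt0 n0 form_lt0 neg_de (da2 _ (A_range _ sde2))
  P2u (intertwine _ _ _ P2u A2E).
move=> gap0.
have l0 : 0 < l%:C :> C by rewrite ltcR /l invr_gt0 ltr0n.
have l1 : 0 < (1 - l)%:C :> C by rewrite ltcR /l; lra.
have comb_lt0 (x y : C) : x < 0 -> y < 0 -> l%:C * x + (1 - l)%:C * y < 0.
  by move=> x0 y0; rewrite -[X in _ < X]addr0; apply: ltrD; rewrite pmulr_rlt0.
by have := le_lt_trans gap0 (comb_lt0 _ _ T1 T2); rewrite ltxx.
Qed.

Lemma psd_hankelmx n (f : R -> R) (t : R) :
  psdmx (hankelmx n f t) <->
  (forall u, 0 <= hankel_form (fun k => derive1n k f) n u t).
Proof.
pose M (i j : 'I_n) : R := derive1n (i.+1 + j.+1) f t / ((i.+1 + j.+1)`!)%:R.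
have Msym i j : M i j = M j i by rewrite /M addnC.
have quad (v : 'cV[C]_n) : (v^t* *m hankelmx n f t *m v) 0 0 =
    \sum_i \sum_j Num.conj (v i 0) * v j 0 * (M i j)%:C.
  rewrite mxE exchange_big /=; apply: eq_bigr => j _.
  by rewrite mxE big_distrl /=; apply: eq_bigr => i _; rewrite !mxE mulrAC.
split=> [[_ psd] u|pos].
  have := psd (\col_i (u i)%:C).
  rewrite quad (sym_real_form (fun i => _ i 0)) // ler0c.
  rewrite [X in _ + X]big1 ?addr0 => [|i _]; last first.
    by rewrite big1 // => j _; rewrite !mxE /= !mul0r.
  congr (0 <= _); apply: eq_bigr => i _; apply: eq_bigr => j _.
  by rewrite !mxE.
split.
  apply/hermP/matrixP => i j; rewrite !mxE conjCE conjc_real.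
  by rewrite addnC.
move=> v; rewrite quad (sym_real_form (fun i => v i 0)) // ler0c.
have real_form (x : 'I_n -> R) : 0 <= \sum_i \sum_j x i * x j * M i j.
  (* The vector x is extended by 0 to all indices. *)
  have := pos (fun k => oapp x 0 (insub k)).
  by congr (0 <= _); apply: eq_bigr => i _; apply: eq_bigr => j _; rewrite !valK.
exact: addr_ge0.
Qed.

End hankel_of_matrix_convex.

Theorem theorem7 (R : realType) (n : nat) (a b : \bar R) (f : R -> R)
    (n_gt0 : (0 < n)%N) (ab : (a < b)%E)
    (fC : Cn_on (2 * n)%N (open_itv a b) f) :
  matrix_convex n (open_itv a b) f <->
  (forall t : R, open_itv a b t -> psdmx (hankelmx n f t)).
Proof.
rewrite mul2n in fC; split=> [fconv t It|psd].
  by apply/psd_hankelmx => u; apply: (hankel_form_ge0 u n_gt0 fC fconv It).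
apply: (matrix_convex_of_hankel n_gt0 (Cn_on_derivs fC)) => t u It.
by have /psd_hankelmx := psd t It; apply.
Qed.
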